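(* Let $X$ be a separable Asplund space and let $Y$ be a reflexive and separable Banach space. Let $K\subset Y$ be a closed convex cone which has a bounded base, and let $k\in K\setminus\{0\}$. Let $f:X\rightarrow Y$ be continuous and strongly $\alpha(\cdot)$-$k$-paraconvex on $X$. Then there is a dense $G_\delta$ subset of $X$ at every point of which $f$ is Fréchet differentiable.
   Context: Spaces are real. $\alpha:[0,+\infty)\to[0,+\infty)$ is a nondecreasing function with $\lim_{t\to 0^+}\alpha(t)/t=0$. A convex cone $K\subset Y$ is a set with $K+K\subset K$ and $\lambda K\subset K$ for all $\lambda\ge 0$; it defines the relation $x\le_K y \Leftrightarrow y-x\in K$. A convex set $B\subset K$ is a base for $K$ if $K=\bigcup\{\lambda b:\lambda\ge0,\ b\in B\}$ and $0\notin \operatorname{cl}B$; a bounded base is a base that is norm bounded. For an open convex set $\Omega\subset X$ and $0\ne k\in K$, a continuous mapping $f:X\to Y$ is strongly $\alpha(\cdot)$-$k$-paraconvex on $\Omega$ if there is a constant $C>0$ such that for all $x,y\in\Omega$ and $0\le\lambda\le1$ $$f(\lambda x+(1-\lambda)y)\le_K \lambda f(x)+(1-\lambda)f(y)+C\min\{\lambda,1-\lambda\}\,\alpha(\|x-y\|)\,k.$$ An Asplund space is a Banach space on which every continuous convex real-valued function defined on an open convex subset is Fréchet differentiable on a dense $G_\delta$ subset of its domain. *)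

(* Defs.v *)
From mathcomp Require Import all_boot all_order all_algebra.
From mathcomp Require Import all_classical all_reals all_analysis.
From mathcomp Require Import borel_hierarchy.

Set Implicit Arguments.
Unset Strict Implicit.
Unset Printing Implicit Defensive.

Import Order.TTheory GRing.Theory Num.Theory.
Import numFieldNormedType.Exports.

Local Open Scope classical_set_scope.
Local Open Scope ring_scope.

Definition separable (T : topologicalType) : Prop :=
  exists2 D : set T, countable D & dense D.

Section Duality.
Context {R : realType}.
Implicit Type Y : normedModType R.

Definition topdual Y : set (Y -> R) :=
  [set g : Y -> R | scalar g /\ continuous g].

(* The operator norm; only meaningful on [topdual Y], where the supremum is
   finite. *)
Definition topdual_norm Y (g : Y -> R) : R :=
  sup [set `|g y| | y in [set y : Y | `|y| <= 1]].

(* A functional on the dual is represented by a map defined on all functions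
   [Y -> R], of which only the values on [topdual Y] matter. *)
Definition bidual Y : set ((Y -> R) -> R) :=
  [set Phi |
    (forall (a : R) (g h : Y -> R), topdual g -> topdual h ->
       Phi (fun y => a * g y + h y) = a * Phi g + Phi h) /\
    exists M : R, forall g : Y -> R, topdual g ->
      `|Phi g| <= M * topdual_norm g].

Definition reflexive_space Y : Prop :=
  forall Phi, @bidual Y Phi ->
    exists y : Y, forall g : Y -> R, topdual g -> Phi g = g y.

End Duality.

Section Asplund.
Context {R : realType}.

(* A real function on the open set [U] is represented by a total function on
   [X]; none of the conditions depends on its values outside [U].  Since [U]
   is open, a subset of [U] is G-delta in [U] iff it is so in [X]. *)
Definition asplund (X : completeNormedModType R) : Prop :=
  forall (U : set X) (phi : X -> R),
    open U -> convex_set U ->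
    {within U, continuous phi} -> convex_function U phi ->
    exists G : set X,
      [/\ Gdelta G, G `<=` U, U `<=` closure G &
          forall x, G x -> differentiable phi x].

End Asplund.

Section Cones.
Context {R : realType}.
Implicit Type Y : normedModType R.

Definition convex_cone Y (K : set Y) : Prop :=
  (forall x y, K x -> K y -> K (x + y)) /\
  (forall (l : R) x, 0 <= l -> K x -> K (l *: x)).

Definition cone_le Y (K : set Y) (x y : Y) : Prop := K (y - x).

Definition cone_base Y (K B : set Y) : Prop :=
  [/\ B `<=` K, convex_set B,
      K = [set x | exists l : R, exists2 b, B b & 0 <= l /\ x = l *: b] &
      ~ closure B 0].

Definition has_bounded_base Y (K : set Y) : Prop :=
  exists2 B : set Y, cone_base K B & bounded_set B.

End Cones.

Section Paraconvexity.
Context {R : realType}.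

(* Moduli are functions on [0, +oo[: values at negative reals are ignored. *)
Definition modulus (alpha : R -> R) : Prop :=
  [/\ forall t, 0 <= t -> 0 <= alpha t,
      forall s t, 0 <= s -> s <= t -> alpha s <= alpha t &
      alpha t / t @[t --> 0^'+] --> 0].

Definition strongly_paraconvex (X Y : normedModType R) (K : set Y)
    (alpha : R -> R) (k : Y) (Omega : set X) (f : X -> Y) : Prop :=
  exists2 C : R, 0 < C &
    forall (x y : X) (l : R), Omega x -> Omega y -> 0 <= l -> l <= 1 ->
      cone_le K (f (l *: x + (1 - l) *: y))
        (l *: f x + (1 - l) *: f y
         + (C * Num.min l (1 - l) * alpha `|x - y|) *: k).

End Paraconvexity.

(* Main.v *)
Require Import Defs.
From HB Require Import structures.
From mathcomp Require Import all_boot all_order all_algebra.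
From mathcomp Require Import all_classical all_reals all_analysis.
From mathcomp Require Import borel_hierarchy.
From mathcomp Require Import ring lra.

Set Implicit Arguments.
Unset Strict Implicit.
Unset Printing Implicit Defensive.

Import Order.TTheory GRing.Theory Num.Theory.
Import numFieldNormedType.Exports.

Local Open Scope classical_set_scope.
Local Open Scope ring_scope.

(* A cone [K] with a bounded base carries a bounded linear functional [phi] with
   [|y| <= M * phi y] on [K]. The affine defect
   [l f(y) + (1 - l) f(z) - f(l y + (1 - l) z)] lies in [K] up to an error
   [o(|y - z|)], so its norm is controlled by the defect of the real function
   [g = phi o f]; and a function with values in a Banach space whose affine
   defect near [x] is [o(|y - z|)] is differentiable at [x]. It remains to see
   that, for every [e > 0], the points near which the defect of [g] is at most
   [e l |y - z|] are dense. On a small ball, the supremum of the slopes of [g] in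
   a given direction is a continuous sublinear function of this direction, hence
   differentiable somewhere because [X] is Asplund; this forces all the slopes of
   [g] near some point of the ball to be close to those of one linear
   functional. *)

(** * Sublinear functions and the Hahn-Banach theorem *)

Section HahnBanach.
Context {R : realType} {V : lmodType R}.
Implicit Types (p q : V -> R) (u x y : V) (a c : R).

Definition sublinear q : Prop :=
  (forall x y, q (x + y) <= q x + q y) /\
  (forall a x, 0 <= a -> q (a *: x) = a * q x).

Lemma sublinear0 q : sublinear q -> q 0 = 0.
Proof. by case=> _ qZ; rewrite -(scale0r 0) qZ ?mul0r. Qed.

Lemma sublinear_geN q x : sublinear q -> - q (- x) <= q x.
Proof.
move=> qs; have [qD _] := qs.
by rewrite lerNl -subr_ge0 opprK -(sublinear0 qs) -(addNr x) qD.
Qed.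

(* This replaces the usual extension of a functional by one dimension: when [S]
   is the ray spanned by [(y, q y)], it gives [q' (- y) <= - q y], so that a
   minimal sublinear function is odd, hence linear. *)
Lemma sublinear_lower q (S : set (V * R)) : sublinear q ->
  S (0, 0) ->
  (forall u c u' c', S (u, c) -> S (u', c') -> S (u + u', c + c')) ->
  (forall a u c, 0 < a -> S (u, c) -> S (a *: u, a * c)) ->
  (forall u c, S (u, c) -> c <= q u) ->
  exists q', [/\ sublinear q', (forall x, q' x <= q x) &
    forall u c, S (u, c) -> q' (- u) <= - c].
Proof.
move=> qs S0 SD SZ Sq; have [qD qZ] := qs.
(* The new function at [x] is the infimum of [q (x + u) - c] over [S]. It is finite because
   [c <= q u <= q (x + u) + q (- x)]. *)
pose E x := [set q (x + w.1) - w.2 | w in S].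
have lbE x : lbound (E x) (- q (- x)).
  move=> _ [[u c] Suc /= <-]; have := Sq _ _ Suc.
  have := qD (x + u) (- x); rewrite addrAC subrr add0r; lra.
have hlE x : has_lbound (E x) by exists (- q (- x)); exact: lbE.
have neE x : E x !=set0 by exists (q (x + 0) - 0), (0, 0).
have ltE x e : 0 < e -> exists u c, S (u, c) /\ q (x + u) - c < inf (E x) + e.
  move=> e0; have [//|_ [[u c] Suc <-] lt] := @inf_adherent R (E x) _ e0.
  by exists u, c.
have leE x u c : S (u, c) -> inf (E x) <= q (x + u) - c.
  by move=> Suc; apply: ge_inf => //; exists (u, c).
have ZE a x : 0 < a -> inf (E (a *: x)) <= a * inf (E x).
  move=> a0; rewrite -ler_pdivrMl//; apply: lb_le_inf => // _ [[u c] Suc <-] /=.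
  rewrite ler_pdivrMl// mulrBr -qZ ?(ltW a0)// scalerDr.
  exact/leE/SZ.
exists (fun x => inf (E x)); split; first split.
- move=> x y; apply/ler_addgt0Pr => e e0.
  have [u [c [Suc ltc]]] := ltE x _ (divr_gt0 e0 (ltr0n _ 2)).
  have [v [d [Svd ltd]]] := ltE y _ (divr_gt0 e0 (ltr0n _ 2)).
  have := leE (x + y) _ _ (SD _ _ _ _ Suc Svd).
  have := qD (x + u) (y + v); rewrite addrACA; lra.
- move=> a x; rewrite le_eqVlt => /predU1P[<-|a0].
    rewrite scale0r mul0r; apply/eqP; rewrite eq_le; apply/andP; split.
      by have := leE 0 _ _ S0; rewrite addr0 subr0 sublinear0.
    by apply: lb_le_inf => //; have := lbE 0; rewrite oppr0 sublinear0// oppr0.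
  apply/eqP; rewrite eq_le ZE// -ler_pdivlMl//.
  by rewrite -{1}(scalerK (lt0r_neq0 a0) x) ZE// invr_gt0.
- by move=> x; have := leE x _ _ S0; rewrite addr0 subr0.
- by move=> u c Suc; have := leE (- u) _ _ Suc; rewrite addNr sublinear0// add0r.
Qed.

(** By Zorn's lemma, a chain being bounded by its pointwise infimum. This infimum is finite since
    every member is at least [- p (- x)] at [x], and it is subadditive since of two members of a
    chain one lies below the other. *)
Lemma minimal_sublinear p : sublinear p ->
  exists q, [/\ sublinear q, (forall x, q x <= p x) &
    forall q', sublinear q' -> (forall x, q' x <= q x) ->
      forall x, q x <= q' x].
Proof.
move=> ps; pose T := {q | sublinear q /\ forall x, q x <= p x}.
pose t0 : T := exist _ p (conj ps (fun=> lexx _)).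
pose le (s t : T) := `[< forall x, sval t x <= sval s x >].
have [|||[q [qs qp]] qmin] := @ZL_preorder T t0 le.
- by move=> t; apply/asboolP.
- move=> r s t /asboolP sr /asboolP ts; apply/asboolP => x.
  exact: le_trans (ts x) (sr x).
- move=> A totA.
  have [[t1 At1]|A0] := pselect (A !=set0); last first.
    by exists t0 => s As; exfalso; apply: A0; exists s.
  pose E x := [set sval t x | t in A].
  have lbE x : lbound (E x) (- p (- x)).
    move=> _ [[q [qs qp]] _ /= <-].
    by rewrite (le_trans _ (sublinear_geN x qs))// lerN2.
  have neE x : E x !=set0 by exists (sval t1 x), t1.
  have hlE x : has_lbound (E x) by exists (- p (- x)); exact: lbE.
  have leE x t : A t -> inf (E x) <= sval t x.
    by move=> At; apply: ge_inf => //; exists t.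
  have ltE x e : 0 < e -> exists t, A t /\ sval t x < inf (E x) + e.
    move=> e0; have [//|_ [t At <-] lt] := @inf_adherent R (E x) _ e0.
    by exists t.
  have Es : sublinear (fun x => inf (E x)).
    split=> [x y|a x a0].
      apply/ler_addgt0Pr => e e0.
      have [s [As lts]] := ltE x _ (divr_gt0 e0 (ltr0n _ 2)).
      have [t [At ltt]] := ltE y _ (divr_gt0 e0 (ltr0n _ 2)).
      have [/asboolP ts|/asboolP st] := totA _ _ As At.
        have := leE (x + y) _ At; have [[+ _] _] := svalP t.
        by move=> /(_ x y); have := ts x; lra.
      have := leE (x + y) _ As; have [[+ _] _] := svalP s.
      by move=> /(_ x y); have := st y; lra.
    apply/eqP; rewrite eq_le; apply/andP; split.
      move: a0; rewrite [0 <= a]le_eqVlt => /predU1P[<-|a0].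
        rewrite mul0r (le_trans (leE _ _ At1))// scale0r.
        by have [/sublinear0 -> _] := svalP t1.
      rewrite -ler_pdivrMl//; apply: lb_le_inf => // _ [t At <-].
      rewrite ler_pdivrMl//; have [[_ tZ] _] := svalP t.
      by rewrite -tZ ?(ltW a0)//; exact: leE.
    apply: lb_le_inf => // _ [t At <-].
    have [[_ ->//] _] := svalP t; rewrite ler_wpM2l//; exact: leE.
  have Ep x : inf (E x) <= p x.
    by rewrite (le_trans (leE _ _ At1))//; have [_] := svalP t1; exact.
  pose tE : T := exist _ (fun x => inf (E x)) (conj Es Ep).
  exists tE => s As; apply/asboolP => x /=; exact: leE.
exists q; split=> // q' q's q'q x.
have q'p y : q' y <= p y by exact: le_trans (q'q y) (qp y).
pose t' : T := exist _ q' (conj q's q'p).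
by have /asboolP := qmin t' (asboolT q'q); exact.
Qed.

Theorem hahn_banach p : sublinear p ->
  exists g : V -> R, scalar g /\ forall x, g x <= p x.
Proof.
move=> /minimal_sublinear[q [qs qp qmin]].
have [qD qZ] := qs.
have qN y : q (- y) = - q y.
  pose S := [set w : V * R | exists2 t : R, 0 <= t & w = (t *: y, t * q y)].
  have [||||q' [q's q'q q'N]] := @sublinear_lower q S qs.
  - by exists 0 => //; rewrite scale0r mul0r.
  - move=> _ _ _ _ [t t0 [-> ->]] [t' t'0 [-> ->]].
    by exists (t + t'); rewrite ?addr_ge0// scalerDl mulrDl.
  - move=> a _ _ a0 [t t0 [-> ->]].
    by exists (a * t); rewrite ?mulr_ge0 ?(ltW a0)// scalerA mulrA.
  - by move=> _ _ [t t0 [-> ->]]; rewrite qZ.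
  - apply/eqP; rewrite eq_le (le_trans (qmin _ q's q'q _))/=.
      by rewrite lerNl sublinear_geN.
    by apply: q'N; exists 1 => //; rewrite scale1r mul1r.
have qDE x y : q (x + y) = q x + q y.
  apply/eqP; rewrite eq_le qD/=.
  have := qD (x + y) (- y); rewrite addrK qN; lra.
exists q; split=> // a x y; rewrite qDE; congr (_ + _).
have [a0|a0] := leP 0 a; first exact: qZ.
by rewrite -[a]opprK scaleNr qN qZ ?oppr_ge0 ?(ltW a0)// -mulNr.
Qed.

End HahnBanach.

(** * A functional that controls the norm on a cone with a bounded base *)

Section Cones.
Context {R : realType} {Y : normedModType R}.

Lemma convex_setP (B : set Y) : convex_set B ->
  forall (l : R) x y, 0 <= l -> l <= 1 -> B x -> B y ->
    B (l *: x + (1 - l) *: y).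
Proof.
move=> cB l x y l0 l1 Bx By.
have := cB x y (Itv01 l0 l1) (mem_set Bx) (mem_set By).
by rewrite inE.
Qed.

(** As 0 is not in the closure of [B], norms on [B] are at least some [d > 0]. So the multiples of
    the pairs [(b, d)] lie below the norm, and a linear functional under the resulting sublinear
    function is at least [d] on [B], where the norm is bounded above. *)
Lemma cone_base_functional (K : set Y) : K !=set0 -> has_bounded_base K ->
  exists (g : Y -> R) (M : R),
    [/\ scalar g, (forall y, g y <= `|y|), 0 < M &
        forall y, K y -> `|y| <= M * g y].
Proof.
move=> [k Kk] [B [BK cB KE clB] [M0 [_ /(_ (`|M0| + 1))bndB]]].
have {}bndB b : B b -> `|b| <= `|M0| + 1.
  by move=> Bb; apply: bndB => //; rewrite (le_lt_trans (ler_norm _))// ltrDl.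
have [b0 Bb0] : B !=set0.
  by move: Kk; rewrite KE => -[l [b Bb _]]; exists b.
have [d d0 dB] : exists2 d : R, 0 < d & forall b, B b -> d <= `|b|.
  apply: contrapT => nd; apply: clB => U /nbhs_norm0P[d /= d0 dU].
  apply: contrapT => BU; apply: nd; exists d => // b Bb.
  rewrite leNgt; apply/negP => bd; apply: BU; exists b; split=> //.
  exact: dU.
pose S := [set w : Y * R | exists (l : R) (b : Y),
  [/\ 0 <= l, B b & w = (l *: b, l * d)]].
have [|||||q [qs qn qS]] := @sublinear_lower R Y (fun y => `|y|) S.
- split=> [x y|a x a0]; first exact: ler_normD.
  by rewrite normrZ ger0_norm.
- by exists 0, b0; rewrite scale0r mul0r.
- move=> _ _ _ _ [l [b [l0 Bb [-> ->]]]] [m [c [m0 Bc [-> ->]]]].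
  have [lm0|lm0] := eqVneq (l + m) 0.
    have [-> ->] : l = 0 /\ m = 0 by split; lra.
    by exists 0, b0; rewrite !scale0r !mul0r !addr0.
  have lm_gt0 : 0 < l + m by rewrite lt_neqAle eq_sym lm0 addr_ge0.
  (* Convexity of the base: [l b + m c] is [l + m] times a convex combination of [b] and [c]. *)
  exists (l + m), ((l / (l + m)) *: b + (1 - l / (l + m)) *: c); split.
  + exact: ltW.
  + apply: convex_setP => //; first by rewrite divr_ge0// ltW.
    by rewrite ler_pdivrMr// mul1r lerDl.
  + rewrite scalerDr !scalerA mulrDl; congr (_ *: _ + _ *: _, _); by field.
- move=> a _ _ a0 [l [b [l0 Bb [-> ->]]]]; exists (a * l), b.
  by rewrite mulr_ge0 ?(ltW a0)// scalerA mulrA.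
- move=> _ _ [l [b [l0 Bb [-> ->]]]].
  by rewrite normrZ ger0_norm// ler_wpM2l// dB.
have [g [gL gq]] := hahn_banach qs.
exists g, ((`|M0| + 1) / d); split=> //.
- by move=> y; exact: le_trans (gq y) (qn y).
- by rewrite divr_gt0// ltr_wpDl.
- move=> y; rewrite KE => -[l [b Bb [l0 ->]]].
  have gZ a x : g (a *: x) = a * g x.
    have g0 : g 0 = 0 by have := gL 1 0 0; rewrite scale1r addr0 mul1r; lra.
    by have := gL a x 0; rewrite !addr0 g0 addr0.
  have dg : d <= g b.
    have := qS (1 *: b) (1 * d); rewrite scale1r mul1r => /(_ _) gb.
    have gbN : g (- b) = - g b by rewrite -scaleN1r gZ mulN1r.
    rewrite -lerN2 -gbN; apply: le_trans (gq _) (gb _).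
    by exists 1, b; rewrite scale1r mul1r.
  rewrite normrZ gZ ger0_norm// mulrCA ler_wpM2l//.
  apply: le_trans (bndB _ Bb) _.
  by rewrite -mulrA ler_peMr ?addr_ge0// ler_pdivlMl// mulr1.
Qed.

End Cones.

(** * Fréchet differentiability in epsilon-delta form *)

Section FrechetDerivative.
Context {R : realType} {V W : normedModType R}.

Lemma differentiable_bound (f : V -> W) (x : V) : differentiable f x ->
  exists2 p : {linear V -> W}, continuous p & forall e : R, 0 < e ->
    exists2 d : R, 0 < d & forall h, `|h| <= d ->
      `|f (x + h) - f x - p h| <= e * `|h|.
Proof.
move=> fx; exists ('d f x); first exact: diff_continuous.
move=> e e0; have /eqaddoP /(_ e e0) := diff_locally fx.
move=> /nbhs_norm0P[d /= d0 dP]; exists (d / 2); first by rewrite divr_gt0.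
move=> h hd; have : `|h| < d by lra.
by move=> /dP /=; rewrite !fctE /= opprD addrA [h + x]addrC.
Qed.

Lemma bound_differentiable (f : V -> W) (x : V) (p : {linear V -> W}) :
  continuous p -> (forall e : R, 0 < e ->
    exists2 d : R, 0 < d & forall h, `|h| < d ->
      `|f (x + h) - f x - p h| <= e * `|h|) -> differentiable f x.
Proof.
move=> pc fp.
have fpo : f \o shift x = cst (f x) + p +o_ 0 id.
  apply/eqaddoP => e e0; have [d d0 dP] := fp e e0.
  apply/nbhs_norm0P; exists d => //= h /dP.
  by rewrite !fctE /= opprD addrA [h + x]addrC.
have dE := diff_unique pc fpo.
by apply/diff_locallyP; rewrite dE.
Qed.

End FrechetDerivative.

(** Cut [[0, s]] into [N] equal pieces of length at most [e]. Their increments telescope to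
    [u s - u 0], so they cannot all be less steep than the average. *)
Lemma steep_subinterval (R : realType) (u : R -> R) (s e : R) :
  0 < s -> 0 < e -> exists a t : R, [/\ 0 <= a, 0 < t, t <= e, a + t <= s &
    t * (u s - u 0) <= s * (u (a + t) - u a)].
Proof.
move=> s0 e0.
pose N := (Num.truncn (s / e)).+1.
have N0 : 0 < N%:R :> R by rewrite ltr0n.
pose t := s / N%:R.
have t0 : 0 < t by rewrite divr_gt0.
have te : t <= e.
  rewrite ler_pdivrMr// -ler_pdivrMl// mulrC ltW//.
  exact: truncnS_gt.
have sE : s = N%:R * t.
  by rewrite mulrC divfK// lt0r_neq0.
apply: contrapT => nP.
have lt i : (i < N)%N -> s * (u (i.+1%:R * t) - u (i%:R * t)) < t * (u s - u 0).
  move=> iN; rewrite ltNge; apply/negP => h; apply: nP.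
  have itE : i%:R * t + t = i.+1%:R * t by rewrite -natr1 mulrDl mul1r.
  exists (i%:R * t), t; rewrite itE; split=> //.
    by rewrite mulr_ge0// ltW.
  by rewrite sE ler_pM2r// ler_nat.
have : \sum_(0 <= i < N) s * (u (i.+1%:R * t) - u (i%:R * t))
     < \sum_(0 <= i < N) t * (u s - u 0).
  rewrite !big_mkord; apply: ltr_sum => [|i _]; last exact: lt.
  by apply/hasP; exists ord0 => //; rewrite mem_index_enum.
rewrite -big_distrr/= telescope_sumr// mul0r -sE sumr_const_nat subn0.
by rewrite -mulr_natl mulrA -sE ltxx.
Qed.

(** * Differentiability from a small affine defect *)

Section AffineDefect.
Context {R : realType}.

Lemma cauchy_at_right0 (Y : completeNormedModType R) (D : R -> Y) :
  (forall e, 0 < e -> exists2 s, 0 < s &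
    forall t, 0 < t -> t <= s -> `|D s - D t| < e) ->
  exists l : Y, forall e, 0 < e ->
    exists2 d, 0 < d & forall t, 0 < t -> t < d -> `|l - D t| < e.
Proof.
move=> cD.
have /cauchy_cvg /cvg_ex[l /cvgrPdist_lt Dl] : cauchy (D t @[t --> 0^'+]).
  apply: cauchy_exP => e e0; have [s s0 sP] := cD e e0.
  exists (D s); rewrite /nbhs/=; near=> t; rewrite -ball_normE/=.
  apply: sP; near: t; first exact: nbhs_right_gt.
  exact: nbhs_right_ltW.
exists l => e /Dl[d /= d0 dP]; exists d => // t t0 td.
by apply: dP => //=; rewrite sub0r normrN gtr0_norm.
Unshelve. all: by end_near. Qed.

(* The difference quotients of [g] at [0] form a Cauchy family, uniformly over
   bounded sets of directions; their limit is additive by the case [l = 1/2]. *)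
Lemma small_affine_defect_linear (X : normedModType R)
    (Y : completeNormedModType R) (g : X -> Y) :
  g 0 = 0 -> {for 0, continuous g} ->
  (forall e : R, 0 < e -> exists2 d : R, 0 < d &
    forall y z (l : R), `|y| < d -> `|z| < d -> 0 <= l -> l <= 1 ->
      `|l *: g y + (1 - l) *: g z - g (l *: y + (1 - l) *: z)|
        <= e * (l * `|y - z|)) ->
  exists2 p : {linear X -> Y}, continuous p & forall e : R, 0 < e ->
    exists2 d : R, 0 < d & forall h, `|h| < d -> `|g h - p h| <= e * `|h|.
Proof.
move=> g0 gc gP; pose D h (t : R) := t^-1 *: g (t *: h).
have DP e : 0 < e -> exists2 d, 0 < d & forall h t s, 0 < t -> t <= s ->
    s * `|h| < d -> `|D h s - D h t| <= e * `|h|.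
  move=> /gP[d d0 dP]; exists d => // h t s t0 ts shd.
  have s0 := lt_le_trans t0 ts.
  (* Since [g 0 = 0], the defect between [s h] and 0 with weight [t / s] is [t] times the difference
     of the two quotients. *)
  have := dP (s *: h) 0 (t / s).
  rewrite normr0 subr0 normrZ gtr0_norm// => /(_ shd d0).
  rewrite divr_ge0 ?(ltW t0) ?(ltW s0)// ler_pdivrMr// mul1r => /(_ isT ts).
  rewrite g0 !scaler0 !addr0 scalerA divfK ?gt_eqF//.
  have -> : t / s * (s * `|h|) = t * `|h| by rewrite mulrA divfK ?gt_eqF.
  move=> le; rewrite -(ler_pM2l t0) -{1}(gtr0_norm t0) -normrZ.
  rewrite [leRHS]mulrCA; apply: le_trans le.
  by rewrite /D scalerBr !scalerA divff ?gt_eqF// scale1r.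
have /choice[L LP] h : exists l : Y, forall e, 0 < e ->
    exists2 d, 0 < d & forall t, 0 < t -> t < d -> `|l - D h t| < e.
  apply: cauchy_at_right0 => e e0.
  have h1 : 0 < `|h| + 1 by rewrite ltr_wpDl.
  have [d d0 dP] := DP _ (divr_gt0 e0 h1).
  exists (d / 2 / (`|h| + 1)); first by rewrite !divr_gt0.
  move=> t t0 ts; apply: le_lt_trans (dP _ _ _ t0 ts _) _.
    rewrite mulrAC ltr_pdivrMr// -!mulrA ltr_pM2l//.
    by have := normr_ge0 h; lra.
  by rewrite mulrAC ltr_pdivrMr// ltr_pM2l// ltrDl.
have LD h k : L (h + k) = L h + L k.
  apply/eqP; rewrite -subr_eq0 -normr_le0; apply/ler_addgt0Pr => e e0.
  rewrite add0r.
  (* One quarter of [e] for each of the three limits, and one for the defect at the midpoint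
     [t (h + k)] of [2 t h] and [2 t k]. *)
  have e4 : 0 < e / 4 by rewrite divr_gt0.
  have hk1 : 0 < `|h - k| + 1 by rewrite ltr_wpDl.
  have [d d0 dP] := gP _ (divr_gt0 e4 hk1).
  have [d1 d10 dP1] := LP (h + k) _ e4.
  have [d2 d20 dP2] := LP h _ e4.
  have [d3 d30 dP3] := LP k _ e4.
  have dw w : 0 < d / (2 * (`|w| + 1)).
    by rewrite divr_gt0// mulr_gt0// ltr_wpDl.
  near (0 : R)^'+ => t.
  have t0 : 0 < t by near: t; exact: nbhs_right_gt.
  have t20 : 0 < 2 * t by rewrite mulr_gt0.
  have td1 : t < d1 by near: t; exact: nbhs_right_lt.
  have td2 : 2 * t < d2.
    rewrite mulrC -ltr_pdivlMr//; near: t.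
    by apply: nbhs_right_lt; rewrite divr_gt0.
  have td3 : 2 * t < d3.
    rewrite mulrC -ltr_pdivlMr//; near: t.
    by apply: nbhs_right_lt; rewrite divr_gt0.
  have tdn w : t < d / (2 * (`|w| + 1)) -> `|(2 * t) *: w| < d.
    rewrite normrZ gtr0_norm// => tw.
    have w1 : 0 < `|w| + 1 by rewrite ltr_wpDl.
    rewrite (@le_lt_trans _ _ (t * (2 * (`|w| + 1))))//.
      by rewrite mulrA [t * 2]mulrC ler_pM2l// lerDl.
    by rewrite -ltr_pdivlMr// mulr_gt0.
  have /tdn hd : t < d / (2 * (`|h| + 1)).
    by near: t; apply: nbhs_right_lt; exact: dw.
  have /tdn kd : t < d / (2 * (`|k| + 1)).
    by near: t; apply: nbhs_right_lt; exact: dw.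
  have half0 : 0 <= 2^-1 :> R by [].
  have half1 : 2^-1 <= 1 :> R by lra.
  have half : 1 - 2^-1 = 2^-1 :> R by field.
  have := dP _ _ _ hd kd half0 half1; rewrite half.
  rewrite -scalerBr normrZ (gtr0_norm t20) -!scalerDr [_ *: (_ *: _)]scalerA.
  have -> : 2^-1 * (2 * t) = t by field.
  have -> : 2^-1 * (2 * t * `|h - k|) = t * `|h - k| by field.
  move=> le.
  have le' : `|D (h + k) t - (D h (2 * t) + D k (2 * t))| <= e / 4.
    rewrite distrC -(ler_pM2l t0) -{1}(gtr0_norm t0) -normrZ.
    rewrite /D scalerBr -scalerDr !scalerA divff ?gt_eqF// scale1r.
    rewrite invfM mulrCA divff ?gt_eqF// mulr1; apply: le_trans le _.
    by rewrite mulrCA ler_pM2l// mulrAC ler_pdivrMr// ler_pM2l// lerDl.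
  have h1 := dP1 _ t0 td1; have h2 := dP2 _ t20 td2; have h3 := dP3 _ t20 td3.
  have := ler_distD (D (h + k) t) (L (h + k)) (L h + L k).
  have := ler_distD (D h (2 * t) + D k (2 * t)) (D (h + k) t) (L h + L k).
  have := ler_normD (D h (2 * t) - L h) (D k (2 * t) - L k).
  rewrite addrACA -opprD [`|D h _ - _|]distrC [`|D k _ - _|]distrC.
  lra.
have LZ0 a h : 0 < a -> L (a *: h) = a *: L h.
  move=> a0; apply/eqP; rewrite -subr_eq0 -normr_le0.
  apply/ler_addgt0Pr => e e0.
  rewrite add0r.
  have e2 : 0 < e / 2 by rewrite divr_gt0.
  have ea2 : 0 < e / 2 / a by rewrite divr_gt0.
  have [d d0 dP] := LP (a *: h) _ e2.
  have [d1 d10 dP1] := LP h _ ea2.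
  near (0 : R)^'+ => t.
  have t0 : 0 < t by near: t; exact: nbhs_right_gt.
  have at0 : 0 < t * a by rewrite mulr_gt0.
  have td : t < d by near: t; exact: nbhs_right_lt.
  have td1 : t * a < d1.
    by rewrite -ltr_pdivlMr//; near: t; apply: nbhs_right_lt; rewrite divr_gt0.
  have DE : D (a *: h) t = a *: D h (t * a).
    by rewrite /D !scalerA invfM mulrCA divff ?gt_eqF// mulr1.
  have h1 := dP _ t0 td; have h2 := dP1 _ at0 td1.
  have := ler_distD (D (a *: h) t) (L (a *: h)) (a *: L h).
  rewrite [X in _ + `|X - _|]DE.
  rewrite -[a *: D _ _ - _]scalerBr normrZ (gtr0_norm a0).
  rewrite [`|D h _ - L h|]distrC.
  have : a * `|L h - D h (t * a)| < e / 2 by rewrite mulrC -ltr_pdivlMr.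
  lra.
have L0 : L 0 = 0.
  by have := LD 0 0; rewrite addr0 => /eqP; rewrite -subr_eq subrr => /eqP.
have LZ a h : L (a *: h) = a *: L h.
  have [a0|a0|->] := ltrgt0P a; first exact: LZ0; last by rewrite !scale0r.
  apply/eqP; rewrite -subr_eq0 -scaleNr -LZ0 ?oppr_gt0// -LD scaleNr subrr.
  by rewrite L0.
have Llin : linear L by move=> a h k; rewrite LD LZ.
pose p : {linear X -> Y} := HB.pack L (GRing.isLinear.Build R X Y *:%R L Llin).
have pP (e : R) : 0 < e -> exists2 d : R, 0 < d &
    forall h, `|h| < d -> `|g h - p h| <= e * `|h|.
  (* [g h] is [D h 1]. The radius [d] comes from [DP], uniformly in [h]; the limit [L h] is then
     approached with an arbitrary error [e'], for which [t] may depend on [h]. *)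
  move=> e0; have [d d0 dP] := DP e e0; exists d => // h hd.
  apply/ler_addgt0Pr => e' e'0; have [d1 d10 dP1] := LP h _ e'0.
  near (0 : R)^'+ => t.
  have t0 : 0 < t by near: t; exact: nbhs_right_gt.
  have t1 : t <= 1 by near: t; exact: nbhs_right_ltW.
  have td1 : t < d1 by near: t; exact: nbhs_right_lt.
  have := dP h t 1 t0 t1; rewrite mul1r => /(_ hd).
  have := dP1 _ t0 td1; have := ler_distD (D h t) (D h 1) (L h).
  have -> : D h 1 = g h by rewrite /D invr1 !scale1r.
  rewrite [`|D h t - L h|]distrC -[p h]/(L h); lra.
exists p => //; apply/bounded_linear_continuous.
(* Continuity of [g] at 0 passes to [p]: near 0, [g h] is bounded by 1 and [g h - p h] by [d]. *)
have [d d0 dP] := pP 1 ltr01.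
apply/ex_bound; exists (1 + d); near=> h.
have hd : `|h| < d by near: h; apply: nbhs0_lt.
have := dP _ hd.
have : `|g h| < 1.
  near: h; have := gc; rewrite /prop_for /continuous_at g0.
  by move/cvgr0_norm_lt; apply.
have := ler_distD (g h) (p h) 0; rewrite !subr0 [`|p h - _|]distrC /=; lra.
Unshelve. all: by end_near. Qed.

(** Translating by [x] and subtracting [f x] preserves the affine defect, because the weights add up
    to 1; this reduces the claim to the point 0. *)
Lemma small_affine_defect_differentiable (X : normedModType R)
    (Y : completeNormedModType R) (f : X -> Y) (x : X) :
  {for x, continuous f} ->
  (forall e : R, 0 < e -> exists2 d : R, 0 < d &
    forall y z (l : R), `|y - x| < d -> `|z - x| < d -> 0 <= l -> l <= 1 ->
      `|l *: f y + (1 - l) *: f z - f (l *: y + (1 - l) *: z)|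
        <= e * (l * `|y - z|)) ->
  differentiable f x.
Proof.
move=> fc fP; pose g h := f (x + h) - f x.
have [||e /fP[d d0 dP]|p pc pP] := @small_affine_defect_linear X Y g.
- by rewrite /g addr0 subrr.
- rewrite /prop_for /continuous_at /g addr0 subrr.
  rewrite -[X in _ --> X](subrr (f x)); apply: cvgB; last exact: cvg_cst.
  have xh : x + h @[h --> (0 : X)] --> x + 0.
    by apply: cvgD; [exact: cvg_cst|exact: cvg_id].
  by rewrite addr0 in xh; exact: (cvg_comp (fun h => x + h) f xh fc).
- exists d => // y z l yd zd l0 l1.
  have := dP (x + y) (x + z) l; rewrite addrAC subrr add0r => /(_ yd).
  rewrite addrAC subrr add0r => /(_ zd l0 l1).
  rewrite !scalerDr addrACA -scalerDl [l + _]addrC subrK scale1r.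
  rewrite opprD addrACA subrr add0r; congr (`|_| <= _).
  rewrite /g /= !scalerN [X in _ = X - _]addrACA -opprD -scalerDl.
  by rewrite [l + _]addrC subrK scale1r opprB [RHS]addrA subrK.
- exact: (bound_differentiable pc).
Qed.

End AffineDefect.

(** * Segments in balls *)

Section BallConvexity.
Context {R : realType} {X : normedModType R}.
Lemma ball_segment (x0 : X) r y z t : 0 <= t -> t <= 1 -> `|y - x0| < r ->
  `|z - x0| < r -> `|t *: y + (1 - t) *: z - x0| < r.
Proof.
move=> t0 t1 yr zr.
have -> : t *: y + (1 - t) *: z - x0 = t *: (y - x0) + (1 - t) *: (z - x0).
  rewrite !scalerBr [RHS]addrACA -opprD -scalerDl.
  by rewrite [t + _]addrC subrK scale1r.
apply: le_lt_trans (ler_normD _ _) _.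
rewrite !normrZ (ger0_norm t0) ger0_norm ?subr_ge0//.
have : Num.max `|y - x0| `|z - x0| < r by rewrite gt_max yr.
have : `|y - x0| <= Num.max `|y - x0| `|z - x0| by rewrite le_max lexx.
have : `|z - x0| <= Num.max `|y - x0| `|z - x0| by rewrite le_max lexx orbT.
nra.
Qed.

Lemma ball_line (x0 : X) r y v s a : 0 < s -> 0 <= a -> a <= s ->
  `|y - x0| < r -> `|y + s *: v - x0| < r -> `|y + a *: v - x0| < r.
Proof.
move=> s0 a0 as_ yr yvr.
have := @ball_segment x0 r (y + s *: v) y (a / s).
have -> : (a / s) *: (y + s *: v) + (1 - a / s) *: y = y + a *: v.
  rewrite scalerDr addrAC -scalerDl [_ / _ + _]addrC subrK scale1r scalerA.
  by rewrite divfK ?gt_eqF.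
by apply; rewrite ?divr_ge0 ?ler_pdivrMr ?mul1r// ltW.
Qed.

End BallConvexity.

(** * The maximal slope on a ball, as a sublinear function of the direction *)

Section Slopes.
Context {R : realType} {X : normedModType R}.
Variables (g : X -> R) (x0 : X) (r L : R).
Hypothesis r0 : 0 < r.
Hypothesis gL : forall y z, `|y - x0| < r -> `|z - x0| < r ->
  g z - g y <= L * `|z - y|.

(** All base points in the ball and all lengths are allowed, so that [max_slope] is a fixed-scale
    analogue of Clarke's directional derivative. *)
Definition slopes (v : X) : set R :=
  [set c | exists y s, [/\ 0 < s, `|y - x0| < r, `|y + s *: v - x0| < r &
    c = (g (y + s *: v) - g y) / s]].

Definition max_slope (v : X) : R := sup (slopes v).

Lemma slopes_bounded v : has_sup (slopes v) /\ max_slope v <= L * `|v|.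
Proof.
have ub : ubound (slopes v) (L * `|v|).
  move=> _ [y [s [s0 yr yvr ->]]]; rewrite ler_pdivrMr//.
  apply: le_trans (gL yr yvr) _.
  by rewrite [y + _]addrC addrK normrZ (gtr0_norm s0) -mulrA [`|v| * _]mulrC.
have ne : slopes v !=set0.
  have v1 : 0 < `|v| + 1 by rewrite ltr_wpDl.
  have s0 : 0 < r / (`|v| + 1) by rewrite divr_gt0.
  exists ((g (x0 + (r / (`|v| + 1)) *: v) - g x0) / (r / (`|v| + 1))).
  exists x0, (r / (`|v| + 1)); split=> //; first by rewrite subrr normr0.
  rewrite [x0 + _]addrC addrK normrZ gtr0_norm// mulrAC ltr_pdivrMr//.
  by rewrite ltr_pM2l// ltrDl.
split; first by split=> //; exists (L * `|v|).
exact: ge_sup.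
Qed.

Lemma max_slope_ge y v s : 0 < s -> `|y - x0| < r -> `|y + s *: v - x0| < r ->
  g (y + s *: v) - g y <= s * max_slope v.
Proof.
move=> s0 yr yvr; rewrite -ler_pdivrMl// mulrC.
have [hs _] := slopes_bounded v.
by apply: sup_upper_bound => //; exists y, s.
Qed.

Lemma steep_subsegment y v s e : 0 < s -> 0 < e ->
  `|y - x0| < r -> `|y + s *: v - x0| < r ->
  exists z t, [/\ 0 < t, t <= e,
    exists2 a, 0 <= a /\ a + t <= s & z = y + a *: v &
    t * (g (y + s *: v) - g y) <= s * (g (z + t *: v) - g z)].
Proof.
move=> s0 e0 yr yvr.
have [a [t [a0 t0 te ats h]]] :=
  steep_subinterval (fun t => g (y + t *: v)) s0 e0.
exists (y + a *: v), t; split=> //; first by exists a.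
by rewrite -addrA -scalerDl; move: h; rewrite scale0r addr0.
Qed.

(** A segment with nearly maximal slope may be long, but one of its short pieces is at least as
    steep. *)
Lemma max_slope_adherent v e d : 0 < e -> 0 < d -> exists y s,
  [/\ 0 < s, s <= d, `|y - x0| < r, `|y + s *: v - x0| < r &
    s * (max_slope v - e) <= g (y + s *: v) - g y].
Proof.
move=> e0 d0; have [hs _] := slopes_bounded v.
have [_ [y [s [s0 yr yvr ->]]] lt] := sup_adherent e0 hs.
have [z [t [t0 td [a [a0 ats] zE] le]]] := steep_subsegment s0 d0 yr yvr.
exists z, t; split=> //.
- by rewrite zE; apply: ball_line s0 _ _ yr yvr => //; lra.
- rewrite zE -[y + _ + _]addrA -scalerDl.
  by apply: ball_line s0 _ _ yr yvr => //; lra.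
- rewrite -(ler_pM2l s0); apply: le_trans le.
  by rewrite mulrCA ler_pM2l// mulrC -ler_pdivlMr// ltW.
Qed.

(** A steep step along [v + w] is a step along [v] followed by one along [w]. The intermediate point
    could leave the ball, so the step is first shortened. *)
Lemma max_slopeD v w : max_slope (v + w) <= max_slope v + max_slope w.
Proof.
apply/ler_addgt0Pr => e e0.
have [hs _] := slopes_bounded (v + w).
have [_ [y [s [s0 yr yvr ->]]] lt] := sup_adherent e0 hs.
(* The whole segment lies in the smaller ball of radius [r'], so that a move of length less than
   [r - r'] from any of its points stays in the ball of radius [r]. *)
pose m := Num.max `|y - x0| `|y + s *: (v + w) - x0|.
pose r' := (m + r) / 2.
have mr : m < r by rewrite gt_max yr.
have mr' : m < r' by rewrite midf_lt.
have r'r : r' < r by rewrite midf_lt.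
have yr' : `|y - x0| < r' by apply: le_lt_trans mr'; rewrite le_max lexx.
have yvr' : `|y + s *: (v + w) - x0| < r'.
  by apply: le_lt_trans mr'; rewrite le_max lexx orbT.
have rr'0 : 0 < r - r' by rewrite subr_gt0.
have v1 : 0 < `|v| + 1 by rewrite ltr_wpDl.
have [z [t [t0 td [a [a0 ats] zE] le]]] :=
  steep_subsegment s0 (divr_gt0 rr'0 v1) yr yvr.
have zr' : `|z - x0| < r'.
  by rewrite zE; apply: ball_line s0 _ _ yr' yvr' => //; lra.
have zr := lt_trans zr' r'r.
have zvr : `|z + t *: v - x0| < r.
  have := ler_normD (z - x0) (t *: v); rewrite normrZ gtr0_norm// addrAC.
  by move: td; rewrite ler_pdivlMr//; nra.
have zvwE : z + t *: v + t *: w = z + t *: (v + w) by rewrite scalerDr addrA.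
have zvwr : `|z + t *: v + t *: w - x0| < r.
  rewrite zvwE zE -[y + _ + _]addrA -scalerDl.
  by apply: ball_line s0 _ _ yr yvr => //; lra.
have h1 := max_slope_ge t0 zr zvr.
have h2 := max_slope_ge t0 zvr zvwr.
have st0 : 0 < s * t by rewrite mulr_gt0.
rewrite -(ler_pM2l st0); move: lt; rewrite -/(max_slope _) ltr_pdivlMr//.
rewrite -(ltr_pM2l t0); move: le; rewrite -zvwE.
have : s * (g (z + t *: v + t *: w) - g z)
    <= s * (t * (max_slope v + max_slope w)).
  rewrite ler_pM2l//; lra.
lra.
Qed.

Lemma max_slopeZ a v : 0 < a -> max_slope (a *: v) <= a * max_slope v.
Proof.
move=> a0; have [[ne _] _] := slopes_bounded (a *: v).
apply: ge_sup => // _ [y [s [s0 yr yvr ->]]].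
rewrite ler_pdivrMr// mulrAC [a * s]mulrC; move: yvr; rewrite scalerA => yvr.
by apply: max_slope_ge => //; rewrite mulr_gt0.
Qed.

Lemma max_slope_sublinear : sublinear max_slope.
Proof.
split=> [x y|a v]; first exact: max_slopeD.
have le0 : max_slope 0 = 0.
  have [[ne _] le] := slopes_bounded 0.
  apply/eqP; rewrite eq_le; apply/andP; split.
    by move: le; rewrite normr0 mulr0.
  have [c [y [s [s0 yr yvr _]]]] := ne; have := max_slope_ge s0 yr yvr.
  by rewrite scaler0 addr0 subrr pmulr_rge0.
rewrite [0 <= a]le_eqVlt => /predU1P[<-|a0]; first by rewrite scale0r mul0r.
apply/eqP; rewrite eq_le max_slopeZ//= -ler_pdivlMl//.
by rewrite -{1}(scalerK (lt0r_neq0 a0) v) max_slopeZ// invr_gt0.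
Qed.

End Slopes.

(** * Real paraconvex functions on an Asplund space *)

Section Paraconvex.
Context {R : realType}.

Lemma modulus_small (b : R -> R) : modulus b -> forall e : R, 0 < e ->
  exists2 d : R, 0 < d & forall t, 0 <= t -> t <= d -> b t <= e * t.
Proof.
move=> [b0 bmono /cvgr0Pnorm_lt blim] e e0.
have [d /= d0 dP] := blim _ e0.
have small t : 0 < t -> t < d -> b t <= e * t.
  move=> t0 td; have := dP t; rewrite /= sub0r normrN gtr0_norm// => /(_ td t0).
  move/ltW/(le_trans (ler_norm _)); by rewrite ler_pdivrMr.
exists (d / 2); first by rewrite divr_gt0.
move=> t; rewrite [0 <= t]le_eqVlt => /predU1P[<- _|t0 td]; last first.
  by apply: small => //; lra.
rewrite mulr0; apply/ler_addgt0Pr => c c0; rewrite add0r.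
(* The limit says nothing at 0 itself; there, monotonicity gives [b 0 <= b s <= e * s <= c] for
   every [c > 0]. *)
pose s := Num.min (d / 2) (c / e).
have s0 : 0 < s by rewrite lt_min !divr_gt0.
have sd : s < d by rewrite gt_min; apply/orP; left; lra.
have sc : s <= c / e by rewrite ge_min lexx orbT.
apply: le_trans (bmono 0 s _ (ltW s0)) _ => //.
apply: le_trans (small _ s0 sd) _.
by rewrite mulrC -ler_pdivlMr.
Qed.

Lemma modulus_scale (b : R -> R) (c : R) : 0 <= c -> modulus b ->
  modulus (fun t => c * b t).
Proof.
move=> c0 [b0 bmono blim]; split=> [t t0|s t s0 st|].
- by rewrite mulr_ge0// b0.
- by rewrite ler_wpM2l// bmono.
- under eq_fun do rewrite -mulrA.
  have := cvgM (cvg_cst c : c @[_ --> (0 : R)^'+] --> c) blim.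
  by rewrite mulr0; apply.
Qed.

Context {X : completeNormedModType R}.

(** A sublinear function is convex, and the bound by [L] makes it Lipschitz, so the Asplund property
    provides a point of Fréchet differentiability. *)
Lemma asplund_sublinear (q : X -> R) (L : R) : asplund X -> sublinear q ->
  (forall v, q v <= L * `|v|) ->
  exists z (p : {linear X -> R}), forall e : R, 0 < e ->
    exists2 d : R, 0 < d & forall h, `|h| <= d ->
      q (z + h) <= q z + p h + e * `|h|.
Proof.
move=> Xa [qD qZ] qL.
have qB x y : q x - q y <= L * `|x - y|.
  by have := qD y (x - y); rewrite addrC subrK; have := qL (x - y); lra.
have qc : continuous q.
  move=> x; apply/cvgrPdist_le => e e0.
  have L1 : 0 < `|L| + 1 by rewrite ltr_wpDl.
  near=> y.
  have xy : `|x - y| <= e / (`|L| + 1).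
    by near: y; apply: cvgr_dist_le => //; rewrite divr_gt0.
  have Le : L * `|x - y| <= e.
    rewrite ler_pdivlMr// in xy.
    by have := ler_norm L; have := normr_ge0 (x - y); nra.
  rewrite ler_norml; have := qB x y; have := qB y x; rewrite distrC; lra.
have [||||G [_ _ TG GP]] := Xa setT q.
- exact: openT.
- by move=> x y l _ _; rewrite inE.
- exact: continuous_subspaceT.
- move=> t x y _ _; have t1 : 0 <= 1 - t%:num by rewrite subr_ge0 le1.
  rewrite convRE -!qZ//.
  exact: qD.

have [z Gz] : G !=set0.
  by have [z [Gz _]] := TG 0 I setT filterT; exists z.
have [p _ pP] := differentiable_bound (GP z Gz).
exists z, p => e /pP[d d0 dP]; exists d => // h /dP; rewrite ler_norml; lra.
Unshelve. all: by end_near. Qed.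

Variables (b : R -> R) (g : X -> R).
Hypothesis bm : modulus b.
Hypothesis gb : forall x y l, 0 <= l -> l <= 1 ->
  g (l *: x + (1 - l) *: y) <= l * g x + (1 - l) * g y + l * b `|x - y|.
Hypothesis gc : continuous g.

Lemma continuous_dist x e : 0 < e -> exists2 d, 0 < d &
  forall y, `|y - x| < d -> `|g y - g x| < e.
Proof.
move=> e0; have gx : {for x, continuous g} by exact: gc.
have /cvgrPdist_lt/(_ e e0)/nbhs_normP[d /= d0 dP] := gx.
by exists d => // y yx; rewrite distrC; apply: dP; rewrite /= distrC.
Qed.

(** As for convex functions: prolong the segment from [y] to [z] by [r], up to [w]. Then [z] is a
    convex combination of [w] and [y] with weight [n / (r + n)] on [w], which bounds [g z - g y] by
    a multiple of [n]. *)
Lemma paraconvex_lipschitz x0 : exists r L : R, 0 < r /\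
  (forall y z, `|y - x0| < r -> `|z - x0| < r -> g z - g y <= L * `|z - y|).
Proof.
have [b0 bmono _] := bm.
have [d d0 dP] := continuous_dist x0 ltr01.
pose r := d / 2; have r0 : 0 < r by rewrite divr_gt0.
have rd : 2 * r = d by rewrite /r; field.
have b3 : 0 <= b (3 * r) by apply: b0; rewrite mulr_ge0// ltW.
have b2 : 0 <= 2 + b (3 * r) by rewrite addr_ge0.
(* Here 2 bounds the oscillation of [g] on the ball of radius [d = 2 r], which contains [w], and
   [3 r] bounds the distance [r + n] from [w] to [y]. *)
exists r, ((2 + b (3 * r)) / r); split=> //.
move=> y z yr zr.
have [->|zy] := eqVneq z y; first by rewrite !subrr normr0 mulr0.
set n := `|z - y|; have n0 : 0 < n by rewrite normr_gt0 subr_eq0.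
have n2 : n < 2 * r.
  have := ler_distD x0 z y; rewrite [`|x0 - y|]distrC -/n; lra.
pose w := z + (r / n) *: (z - y).
have wyE : w - y = ((r + n) / n) *: (z - y).
  rewrite /w addrAC -{1}[z - y]scale1r -scalerDl.
  by rewrite mulrDl divff ?gt_eqF// addrC.
have wy : `|w - y| = r + n.
  rewrite wyE normrZ -/n ger0_norm ?divfK ?gt_eqF//.
  by rewrite divr_ge0// ltW// addr_gt0.
have wx0 : `|w - x0| < d.
  rewrite /w addrAC; apply: le_lt_trans (ler_normD _ _) _.
  have rn0 : 0 <= r / n by rewrite divr_ge0// ltW.
  by rewrite normrZ -/n ger0_norm// divfK ?gt_eqF//; lra.
have rn : 0 < r + n by rewrite addr_gt0.
have l0 : 0 <= n / (r + n) by rewrite divr_ge0// ltW.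
have l1 : n / (r + n) <= 1 by rewrite ler_pdivrMr// mul1r; lra.
have := gb w y l0 l1.
have -> : (n / (r + n)) *: w + (1 - n / (r + n)) *: y = z.
  rewrite scalerBl scale1r addrCA -scalerBr wyE scalerA.
  have -> : n / (r + n) * ((r + n) / n) = 1 by field; rewrite !gt_eqF.
  by rewrite scale1r addrC subrK.
rewrite wy => le.
have br : b (r + n) <= b (3 * r) by apply: bmono; lra.
have yd : `|y - x0| < d by lra.
have gw := dP _ wx0; have gy := dP _ yd.
rewrite !ltr_norml in gw gy.
have h : n / (r + n) * (g w - g y + b (r + n)) <= n / (r + n) * (2 + b (3 * r)).
  by rewrite ler_wpM2l//; lra.
have h2 : n / (r + n) * (2 + b (3 * r)) <= (2 + b (3 * r)) / r * n.
  rewrite mulrC -mulrA [r^-1 * n]mulrC ler_wpM2l// ler_wpM2l ?(ltW n0)//.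
  by rewrite lef_pV2 ?posrE//; lra.
apply: le_trans h2; apply: le_trans h; lra.
Qed.

(* If [z] is a point of differentiability of the maximal slope, with derivative
   [p], and [x] is a point with nearly maximal slope towards [z], then the
   approximate monotonicity of slopes forces the slope towards [- z] to be nearly
   [- max_slope z] around [x + s z]; since [h = - z + (z + h)], slopes towards
   [h] are then bounded by about [max_slope (z + h) - max_slope z], which is
   nearly [p h]. *)
Lemma paraconvex_almost_affine : asplund X ->
  forall (e : R) x0 r0, 0 < e -> 0 < r0 ->
  exists x1 d (p : {linear X -> R}), [/\ `|x1 - x0| < r0, 0 < d &
    forall y y', `|y - x1| < d -> `|y' - x1| < d ->
      g y' - g y <= p (y' - y) + e * `|y' - y|].
Proof.
move=> Xa e x0 r0 e0 r00.
have [r1 [L [r10 gL1]]] := paraconvex_lipschitz x0.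
pose r := Num.min r0 r1.
have r_gt0 : 0 < r by rewrite lt_min r00.
have rr0 : r <= r0 by rewrite ge_min lexx.
have gL y z : `|y - x0| < r -> `|z - x0| < r -> g z - g y <= L * `|z - y|.
  have rr1 : r <= r1 by rewrite ge_min lexx orbT.
  by move=> yr zr; apply: gL1; exact: lt_le_trans rr1.
pose sg := max_slope g x0 r.
have sgL v : sg v <= L * `|v| by have [] := slopes_bounded r_gt0 gL v.
have [z [p pP]] := asplund_sublinear Xa (max_slope_sublinear r_gt0 gL) sgL.
have e2 : 0 < e / 2 by rewrite divr_gt0.
have [del del0 delP] := pP _ e2.
(* With [t * del = n], the slope error [4 (t c)] is half of [e n]; the other half comes from the
   derivative estimate at [z]. *)
pose c := e * del / 8.
have c0 : 0 < c by rewrite !divr_gt0// mulr_gt0.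
have z1 : 0 < `|z| + 1 by rewrite ltr_wpDl.
have [d1 d10 d1P] := modulus_small bm (divr_gt0 c0 z1).
have [x [s [s0 sd xr xzr xs]]] :=
  max_slope_adherent r_gt0 gL z c0 (divr_gt0 d10 z1).
have bs : b (s * `|z|) <= c * s.
  apply: le_trans (d1P _ _ _) _; first by rewrite mulr_ge0// ltW.
    rewrite ler_pdivlMr// in sd; apply: le_trans sd.
    by rewrite ler_pM2l// lerDl.
  by rewrite -mulrA ler_pM2l// mulrC ler_pdivrMr// ler_pM2l// lerDl.
pose x1 := x + s *: z; rewrite -/x1 in xzr xs.
have cs0 : 0 < c * s by rewrite mulr_gt0.
have [d2 d20 d2P] := continuous_dist x cs0.
have [d3 d30 d3P] := continuous_dist x1 cs0.
pose m := r - `|x1 - x0|.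
have m0 : 0 < m by rewrite subr_gt0.
have k0 : 0 < 1 + 2 * `|z| / del by rewrite ltr_pwDl// divr_ge0// ltW.
(* The bounds [d2] and [d3] keep [g] within [c s] of its values at [x] and [x1], the third keeps
   [y - t z] in the ball, and the last gives [t <= s]. *)
pose d := Num.min (Num.min d2 d3)
  (Num.min (m / (1 + 2 * `|z| / del)) (s * del / 2)).
have d_gt0 : 0 < d by rewrite !lt_min d20 d30 !divr_gt0// mulr_gt0.
have dd2 : d <= d2 by rewrite !ge_min lexx.
have dd3 : d <= d3 by rewrite !ge_min lexx orbT.
have dm : d * (1 + 2 * `|z| / del) <= m.
  by rewrite -ler_pdivlMr// !ge_min lexx !orbT.
have ds : d <= s * del / 2 by rewrite !ge_min lexx !orbT.
exists x1, d, p; split=> //; first exact: lt_le_trans xzr rr0.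
move=> y y' yd y'd.
have [->|y'y] := eqVneq y' y.
  by rewrite !subrr linear0 normr0 mulr0 addr0.
pose n := `|y' - y|; have n0 : 0 < n by rewrite normr_gt0 subr_eq0.
have n2d : n < 2 * d.
  have := ler_distD x1 y' y; rewrite [`|x1 - y|]distrC -/n; lra.
pose t := n / del; have t0 : 0 < t by rewrite divr_gt0.
have tdel : t * del = n by rewrite divfK// gt_eqF.
have ts : t <= s by rewrite ler_pdivrMr//; lra.
(* The direction is rescaled to norm [del], the full radius of the derivative estimate, so the path
   from [y - t z] to [y'] is [t (z + h)]. *)
pose h := t^-1 *: (y' - y).
have hdel : `|h| = del.
  by rewrite normrZ gtr0_norm ?invr_gt0// -/n -tdel mulKf ?gt_eqF.
have th : t *: h = y' - y by rewrite scalerA divff ?scale1r// gt_eqF.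
have ur : `|y - t *: z - x0| < r.
  have -> : y - t *: z - x0 = (y - x1) + ((x1 - x0) - t *: z).
    by rewrite -[x1 - x0 - _]addrA subrKA addrAC addrA.
  have := ler_normD (y - x1) ((x1 - x0) - t *: z).
  have := ler_normB (x1 - x0) (t *: z); rewrite normrZ gtr0_norm//.
  have : t * `|z| <= 2 * d * `|z| / del.
    by rewrite ler_pdivlMr// mulrAC tdel ler_wpM2r// ltW.
  have -> : 2 * d * `|z| / del = d * (1 + 2 * `|z| / del) - d by ring.
  rewrite /m in dm; lra.
have y'E : y - t *: z + t *: (z + h) = y'.
  by rewrite scalerDr addrA subrK th addrC subrK.
have y'r : `|y' - x0| < r.
  have := ler_normD (y' - x1) (x1 - x0); rewrite addrA subrK => le.
  have : 0 <= 2 * `|z| / del by rewrite divr_ge0// ltW.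
  rewrite /m in dm; nra.
have up : g y' - g (y - t *: z) <= t * sg (z + h).
  rewrite -y'E; apply: max_slope_ge => //; rewrite ?y'E//.
  exact: gL.
have ts0 : 0 <= t / s by rewrite divr_ge0// ltW.
have ts1 : t / s <= 1 by rewrite ler_pdivrMr// mul1r.
(* [y - t z] lies between [y - s z] and [y], so paraconvexity carries the slope over length [s] to
   the shorter length [t]. *)
have down := gb (y - s *: z) y ts0 ts1.
have uE : (t / s) *: (y - s *: z) + (1 - t / s) *: y = y - t *: z.
  rewrite scalerBr scalerA divfK ?gt_eqF// addrAC -scalerDl.
  by rewrite [t / s + _]addrC subrK scale1r.
rewrite uE [y - s *: z - y]addrAC subrr sub0r normrN normrZ gtr0_norm// in down.
have gx : `|g (y - s *: z) - g x| < c * s.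
  apply: d2P; rewrite addrAC; have -> : y - x - s *: z = y - x1.
    by rewrite /x1 opprD addrA.
  exact: lt_le_trans dd2.
have gy : `|g y - g x1| < c * s by apply: d3P; exact: lt_le_trans dd3.
(* Of the four errors [t c], one comes from near-maximality, two from moving the endpoints [x] and
   [x1], and one from the modulus. *)
have slope : g (y - t *: z) - g y <= - t * sg z + 4 * (t * c).
  have gd : s * (sg z - c) - 2 * (c * s) <= g y - g (y - s *: z).
    by move: gx gy; rewrite !ltr_norml -/sg in xs *; lra.
  have : t / s * (s * (sg z - c) - 2 * (c * s))
      <= t / s * (g y - g (y - s *: z)).
    by rewrite ler_wpM2l.
  have -> : t / s * (s * (sg z - c) - 2 * (c * s)) = t * sg z - 3 * (t * c).
    by field; rewrite gt_eqF.
  have : t / s * b (s * `|z|) <= t * c.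
    by rewrite -mulrA ler_pM2l// mulrC ler_pdivrMr.
  lra.
have sh : t * sg (z + h) <= t * (sg z + p h + e / 2 * del).
  by rewrite ler_pM2l// -hdel; apply: delP; rewrite hdel.
have ph : t * p h = p (y' - y) by rewrite -th [RHS]linearZ.
have : 4 * (t * c) + t * (e / 2 * del) = e * n by rewrite /c -tdel; field.
rewrite -/n; lra.
Qed.

(** The almost affine estimate is applied from the convex combination [w] to both endpoints. In the
    weighted sum the linear terms cancel, and the errors add up to [e l (1 - l) |y - z|]. *)
Lemma paraconvex_small_defect : asplund X ->
  forall (e : R) x0 r0, 0 < e -> 0 < r0 ->
  exists x1 d, [/\ `|x1 - x0| < r0, 0 < d &
    forall y z l, `|y - x1| < d -> `|z - x1| < d -> 0 <= l -> l <= 1 ->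
      l * g y + (1 - l) * g z - g (l *: y + (1 - l) *: z)
        <= e * (l * `|y - z|)].
Proof.
move=> Xa e x0 r0 e0 r00.
have e2 : 0 < e / 2 by rewrite divr_gt0.
have [x1 [d [p [x1r d0 gp]]]] := paraconvex_almost_affine Xa x0 e2 r00.
exists x1, d; split=> // y z l yd zd l0 l1.
pose w := l *: y + (1 - l) *: z.
have wd : `|w - x1| < d by exact: ball_segment.
have ywE : y - w = (1 - l) *: (y - z).
  by rewrite scalerBr [(1 - l) *: y]scalerBl scale1r /w opprD addrA.
have zwE : z - w = l *: (z - y).
  rewrite /w [(1 - l) *: z]scalerBl scale1r addrCA opprD addrA subrr add0r.
  by rewrite opprB scalerBr.
have := gp _ _ wd yd; rewrite ywE linearZ normrZ ger0_norm ?subr_ge0// => h1.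
have := gp _ _ wd zd; rewrite zwE linearZ normrZ ger0_norm// distrC => h2.
have pN : p (z - y) = - p (y - z) by rewrite -linearN opprB.
rewrite pN in h2.
have l1' : 0 <= 1 - l by rewrite subr_ge0.
have := ler_wpM2l l0 h1; have := ler_wpM2l l1' h2.
have := normr_ge0 (y - z); rewrite -/w /=.
have : 0 <= e * l * l * `|y - z| by rewrite !mulr_ge0// ltW.
rewrite /GRing.scale/=; lra.
Qed.

End Paraconvex.

(** * The residual set of differentiability points *)

Theorem theorem4p1 (R : realType) (X Y : completeNormedModType R)
  (alpha : R -> R) (K : set Y) (k : Y) (f : X -> Y)
  (X_separable : separable X) (X_asplund : asplund X)
  (Y_reflexive : reflexive_space Y) (Y_separable : separable Y)
  (alpha_modulus : modulus alpha)
  (K_closed : closed K) (K_cone : convex_cone K)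
  (K_base : has_bounded_base K)
  (kK : K k) (k_neq0 : k <> 0)
  (f_continuous : continuous f)
  (f_paraconvex : strongly_paraconvex K alpha k [set: X] f) :
  exists G : set X,
    [/\ Gdelta G, dense G & forall x, G x -> differentiable f x].
Proof.
have [phi [M [phiL phi1 M0 phiK]]] :=
  cone_base_functional (ex_intro _ k kK) K_base.
pose p : {linear Y -> R} :=
  HB.pack phi (GRing.isLinear.Build R Y R *:%R phi phiL).
have pB y z : p y - p z <= `|y - z| by rewrite -linearB; exact: phi1.
have pZ (c : R) y : p (c *: y) = c * p y by exact: linearZ.
have p_cont : continuous p.
  move=> y; apply/cvgrPdist_le => e e0; near=> z.
  have yz : `|y - z| <= e by near: z; exact: cvgr_dist_le.
  by rewrite ler_norml; have := pB y z; have := pB z y; rewrite distrC; lra.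
pose g := p \o f.
have g_cont : continuous g.
  by move=> x; apply: continuous_comp; [exact: f_continuous|exact: p_cont].
have [C C0 fpc] := f_paraconvex.
have pk0 : 0 <= p k.
  by rewrite -(pmulr_rge0 _ M0); exact: le_trans (normr_ge0 _) (phiK _ kK).
pose b t := C * p k * alpha t.
have bm : modulus b by apply: modulus_scale => //; rewrite mulr_ge0// ltW.
pose defect x y l := l *: f x + (1 - l) *: f y - f (l *: x + (1 - l) *: y).
have fK x y l : 0 <= l -> l <= 1 ->
    K (defect x y l + (C * Num.min l (1 - l) * alpha `|x - y|) *: k).
  by move=> l0 l1; rewrite addrAC; exact: fpc.
have pdefect x y l :
    p (defect x y l) = l * g x + (1 - l) * g y - g (l *: x + (1 - l) *: y).
  by rewrite /defect linearB linearD !pZ.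
have alpha0 t : 0 <= t -> 0 <= alpha t by case: alpha_modulus => + _ _; exact.
have min_le (x y : X) (l : R) :
    C * Num.min l (1 - l) * alpha `|x - y| <= l * (C * alpha `|x - y|).
  have : Num.min l (1 - l) <= l by rewrite ge_min lexx.
  have : 0 <= C * alpha `|x - y| by rewrite mulr_ge0 ?alpha0// ltW.
  nra.
have phiK' y : K y -> `|y| <= M * p y by exact: phiK.
have gb x y l : 0 <= l -> l <= 1 ->
    g (l *: x + (1 - l) *: y) <= l * g x + (1 - l) * g y + l * b `|x - y|.
  move=> l0 l1; have := le_trans (normr_ge0 _) (phiK' _ (fK x y l l0 l1)).
  rewrite pmulr_rge0// linearD pZ pdefect.
  have := ler_wpM2r pk0 (min_le x y l); rewrite /b; lra.
(* The estimate is required on a whole ball around [x], hence holds around nearby points too; this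
   makes [O e] open. *)
pose O (e : R) := [set x : X | exists2 d, 0 < d & forall y z l,
  `|y - x| < d -> `|z - x| < d -> 0 <= l -> l <= 1 ->
    p (defect y z l) <= e * (l * `|y - z|)].
have O_open e : open (O e).
  rewrite openE => x [d d0 dP]; apply/nbhs_normP; exists (d / 2) => /=.
    by rewrite divr_gt0.
  move=> w /= xw; exists (d / 2); first by rewrite divr_gt0.
  move=> y z l yw zw; apply: dP.
    by have := ler_distD w y x; rewrite [`|w - x|]distrC; lra.
  by have := ler_distD w z x; rewrite [`|w - x|]distrC; lra.
have O_dense e : 0 < e -> dense (O e).
  move=> e0 U [x0 Ux0]; rewrite openE => /(_ _ Ux0)/nbhs_normP[r /= r0 rU].
  have [x1 [d [x1r d0 dP]]] :=
    paraconvex_small_defect bm gb g_cont X_asplund x0 e0 r0.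
  exists x1; split; first by apply: rU; rewrite /= distrC.
  by exists d => // y z l yd zd l0 l1; rewrite pdefect; exact: dP.
pose F n := O n.+1%:R^-1.
exists (\bigcap_n F n); split.
- by exists F => // n; exact: O_open.
- by apply: Baire => n; split; [exact: O_open|exact: O_dense].
- move=> x Fx; apply: small_affine_defect_differentiable => [|e e0].
    exact: f_continuous.
  (* The correction [c k] that brings the defect into [K] costs [c M p(k)] in the cone estimate and
     [c |k|] when it is subtracted again. [Q + 1] is a positive divisor. *)
  pose Q := C * (M * p k + `|k|).
  have Q1 : 0 < Q + 1.
    by rewrite ltr_wpDl// mulr_ge0 ?(ltW C0)// addr_ge0// mulr_ge0// ltW.
  have [d1 d10 d1P] :=
    modulus_small alpha_modulus (divr_gt0 (divr_gt0 e0 (ltr0n _ 2)) Q1).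
  (* This [n] makes the contribution of [M * p (defect y z l)] at most half of the allowed error;
     the modulus terms take the other half. *)
  pose n := Num.truncn (2 * M / e).
  have nM : n.+1%:R^-1 * M <= e / 2.
    have n0 : 0 < n.+1%:R :> R by rewrite ltr0n.
    have : 2 * M / e < n.+1%:R by exact: truncnS_gt.
    by rewrite ler_pdivrMl// ltr_pdivrMr//; lra.
  have [d2 d20 d2P] := Fx n I.
  exists (Num.min (d1 / 2) d2); first by rewrite lt_min divr_gt0.
  move=> y z l; rewrite !lt_min => /andP[yd1 yd2] /andP[zd1 zd2] l0 l1.
  have yz : `|y - z| <= d1.
    by have := ler_distD x y z; rewrite [`|x - z|]distrC; lra.
  have h1 := phiK' _ (fK y z l l0 l1).
  have h2 := d1P _ (normr_ge0 (y - z)) yz.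
  have h3 := d2P _ _ _ yd2 zd2 l0 l1.
  set c := C * Num.min l (1 - l) * alpha `|y - z| in h1.
  have c0 : 0 <= c.
    by rewrite !mulr_ge0 ?alpha0 ?(ltW C0)// le_min l0 subr_ge0.
  have cl : c <= l * (C * alpha `|y - z|) by exact: min_le.
  have := ler_normB (defect y z l + c *: k) (c *: k).
  rewrite addrK normrZ (ger0_norm c0) => h4.
  rewrite linearD pZ in h1.
  have h5 : c * (M * p k + `|k|) <= l * (Q * alpha `|y - z|).
    have -> : l * (Q * alpha `|y - z|) =
        l * (C * alpha `|y - z|) * (M * p k + `|k|).
      by rewrite /Q; ring.
    by rewrite ler_wpM2r// addr_ge0// mulr_ge0// ltW.
  have h6 : l * (Q * alpha `|y - z|) <= l * (e / 2 * `|y - z|).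
    rewrite ler_wpM2l//; apply: le_trans (_ : (Q + 1) * alpha `|y - z| <= _).
      by rewrite ler_wpM2r ?alpha0// lerDl.
    by rewrite mulrC -ler_pdivlMr//; apply: le_trans h2 _; rewrite mulrAC.
  have h7 : M * p (defect y z l) <= l * (e / 2 * `|y - z|).
    apply: le_trans (ler_wpM2l (ltW M0) h3) _.
    by rewrite [leRHS]mulrCA [leLHS]mulrA [M * _]mulrC ler_wpM2r// mulr_ge0.
  apply: le_trans h4 _; lra.
Unshelve. all: by end_near. Qed.
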